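(* For every integer $n\ge 2$, the generalized solvable Baumslag-Solitar group $\Gamma_n$ has property $R_\infty$.
   Context: For an integer $n\ge 2$ with prime decomposition $n=p_1^{y_1}\cdots p_r^{y_r}$ (the $p_i$ pairwise distinct primes, $y_i\ge 1$), $$\Gamma_n=\langle a,t_1,\dots,t_r\mid t_it_j=t_jt_i\ (i\ne j),\ t_iat_i^{-1}=a^{p_i^{y_i}}\ (i=1,\dots,r)\rangle.$$ A group $G$ has property $R_\infty$ if for every $\varphi\in\mathrm{Aut}(G)$ the number $R(\varphi)$ of equivalence classes of the relation on $G$ given by $g\sim h\iff zg\varphi(z)^{-1}=h$ for some $z\in G$ is infinite. *)

(* Defs.v *)
From HB Require Import structures.
From mathcomp Require Import all_boot all_classical.

Set Implicit Arguments.
Unset Strict Implicit.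
Unset Printing Implicit Defensive.

Local Open Scope quotient_scope.

(* Words over X: the letter (x, false) stands for x, (x, true) for x^-1. *)
Definition word (X : Type) := seq (X * bool).

Definition gen (X : Type) (x : X) : word X := [:: (x, false)].

Definition word_inv (X : Type) (w : word X) : word X :=
  rev [seq (l.1, ~~ l.2) | l <- w].

(* Two words denote the same element of < X | u = v for R u v > exactly when
   they are related by the least congruence on the free monoid of words that
   contains R and identifies x x^-1 and x^-1 x with the empty word. *)
Inductive pres_eq (X : Type) (R : word X -> word X -> Prop) :
    word X -> word X -> Prop :=
| pres_rel u v of R u v : pres_eq R u v
| pres_cancel x b : pres_eq R [:: (x, b); (x, ~~ b)] [::]
| pres_refl u : pres_eq R u u
| pres_sym u v of pres_eq R u v : pres_eq R v u
| pres_trans u v w of pres_eq R u v & pres_eq R v w : pres_eq R u w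
| pres_cat u u' v v' of pres_eq R u u' & pres_eq R v v' :
    pres_eq R (u ++ v) (u' ++ v').

Section PresentedGroup.
Variables (X : choiceType) (R : word X -> word X -> Prop).

Definition pres_eqb (u v : word X) : bool := `[< pres_eq R u v >].

Lemma pres_eqb_refl : reflexive pres_eqb.
Proof. by move=> u; apply/asboolP/pres_refl. Qed.

Lemma pres_eqb_sym : symmetric pres_eqb.
Proof. by move=> u v; apply/asboolP/asboolP => /pres_sym. Qed.

Lemma pres_eqb_trans : transitive pres_eqb.
Proof.
by move=> v u w /asboolP uv /asboolP vw; apply/asboolP/(pres_trans uv).
Qed.

Canonical pres_equiv :=
  EquivRel pres_eqb pres_eqb_refl pres_eqb_sym pres_eqb_trans.

Definition presented_group := {eq_quot pres_equiv}.

HB.instance Definition _ := Choice.on presented_group.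
HB.instance Definition _ := EqQuotient.on presented_group.

Lemma presP (u v : word X) :
  \pi_presented_group u = \pi_presented_group v <-> pres_eq R u v.
Proof.
split=> [/eqP | uv]; first by rewrite eqmodE => /asboolP.
by apply/eqP; rewrite eqmodE; apply/asboolP.
Qed.

Definition pres_one : presented_group := \pi_presented_group [::].
Definition pres_mul (g h : presented_group) : presented_group :=
  \pi_presented_group (repr g ++ repr h).
Definition pres_inv (g : presented_group) : presented_group :=
  \pi_presented_group (word_inv (repr g)).

Lemma pres_repr (u : word X) : pres_eq R (repr (\pi_presented_group u)) u.
Proof. by apply/presP; rewrite reprK. Qed.

Lemma pi_pres_mul (u v : word X) :
  pres_mul (\pi_presented_group u) (\pi_presented_group v) =
  \pi_presented_group (u ++ v).
Proof. by apply/presP/pres_cat; apply: pres_repr. Qed.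

Lemma pres_mulA : associative pres_mul.
Proof.
elim/quotW=> u; elim/quotW=> v; elim/quotW=> w.
by rewrite (pi_pres_mul v w) (pi_pres_mul u v) !pi_pres_mul catA.
Qed.

Lemma pres_mul1 : left_id pres_one pres_mul.
Proof. by move=> g; rewrite -[g]reprK pi_pres_mul. Qed.

Lemma pres_mulr1 : right_id pres_one pres_mul.
Proof. by move=> g; rewrite -[g]reprK pi_pres_mul cats0. Qed.

Lemma word_invK : involutive (@word_inv X).
Proof.
move=> w; rewrite /word_inv map_rev revK -map_comp -[RHS]map_id.
by apply: eq_map => -[x b] /=; rewrite negbK.
Qed.

Lemma pres_eq_mulV (w : word X) : pres_eq R (w ++ word_inv w) [::].
Proof.
elim: w => [|[x b] w IHw]; first exact: pres_refl.
rewrite /word_inv /= rev_cons -cats1 catA.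
apply: pres_trans (pres_cancel R x b).
apply: (@pres_cat _ _ [:: (x, b)] [:: (x, b)] _ [:: (x, ~~ b)]);
  first exact: pres_refl.
exact: (pres_cat IHw (pres_refl _ _)).
Qed.

Lemma pres_mulV : left_inverse pres_one pres_inv pres_mul.
Proof.
move=> g; rewrite -{2}[g]reprK pi_pres_mul; apply/presP.
by have := pres_eq_mulV (word_inv (repr g)); rewrite word_invK.
Qed.

Lemma pres_mulrV : right_inverse pres_one pres_inv pres_mul.
Proof.
by move=> g; rewrite -{1}[g]reprK pi_pres_mul; apply/presP/pres_eq_mulV.
Qed.

HB.instance Definition _ := isGroup.Build presented_group
  pres_mulA pres_mul1 pres_mulr1 pres_mulV pres_mulrV.

End PresentedGroup.

Section Gamma.
Variable n : nat.

Definition Gamma_rank := size (primes n).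

(* p_i ^ y_i *)
Definition Gamma_pow (i : 'I_Gamma_rank) : nat :=
  let p := tnth (in_tuple (primes n)) i in p ^ logn p n.

Definition Gamma_gen := option 'I_Gamma_rank.
HB.instance Definition _ := Choice.on Gamma_gen.

Definition Gamma_a : word Gamma_gen := gen None.
Definition Gamma_t (i : 'I_Gamma_rank) : word Gamma_gen := gen (Some i).

Inductive Gamma_rel : word Gamma_gen -> word Gamma_gen -> Prop :=
| Gamma_rel_comm i j of i != j :
    Gamma_rel (Gamma_t i ++ Gamma_t j) (Gamma_t j ++ Gamma_t i)
| Gamma_rel_conj i :
    Gamma_rel (Gamma_t i ++ Gamma_a ++ word_inv (Gamma_t i))
              (flatten (nseq (Gamma_pow i) Gamma_a)).

Definition Gamma : groupType := presented_group Gamma_rel.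

End Gamma.

Section TwistedConjugacy.
Local Open Scope group_scope.
Local Open Scope classical_set_scope.
Variable G : groupType.

Definition twisted_conj (phi : G -> G) (g h : G) : Prop :=
  exists z : G, z * g * (phi z)^-1 = h.

Definition twisted_class (phi : G -> G) (g : G) : set G :=
  [set h | twisted_conj phi g h].

Definition R_infty : Prop :=
  forall phi : {multiplicative G -> G}, bijective phi ->
    infinite_set (range (twisted_class phi)).

End TwistedConjugacy.

(* Main.v *)
Require Import Defs.
From mathcomp Require Import all_boot all_classical.
From mathcomp Require Import all_order all_algebra.
From mathcomp Require Import ring.

(** Write q_i for the prime powers p_i ^ y_i.  The group Gamma_n acts on the
    rationals by affine maps, a as x |-> x + 1 and t_i as x |-> q_i x.  The
    slope of this action is a homomorphism from Gamma_n to the positive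
    rationals, and it sends t_i to q_i > 1, so its image is infinite.  It is
    therefore enough that slope (phi g) = slope g for every automorphism phi:
    the slope is then constant on each phi-twisted conjugacy class, and the
    powers of a single t_i lie in infinitely many of them
    (infinite_twisted_classes).

    To see that the slope is preserved, apply phi to t_i a = a ^ q_i t_i.
    Comparing slopes, s = slope (phi a) satisfies s = s ^ q_i, and s > 0 forces
    s = 1: phi a acts as a translation x |-> x + b (slope_phi_a).  Comparing
    the images of 0 gives slope (phi t_i) * b = q_i * b.  So slope (phi t_i) =
    q_i = slope t_i once b is nonzero (slope_phi_t).

    If b were 0, the action precomposed with phi would kill a, and the remaining
    generators commute, so all of phi (Gamma_n) would act by commuting maps.
    Since phi is onto, the translation by 1 would commute with the scaling by
    q_i, which is absurd (aff_phi_a_neq0). *)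

Set Implicit Arguments.
Unset Strict Implicit.
Unset Printing Implicit Defensive.

Import Order.TTheory GRing.Theory Num.Theory.
Local Open Scope quotient_scope.
Local Open Scope ring_scope.

Section Multiplicative.
Variables (G H : groupType) (phi : {multiplicative G -> H}).
Local Open Scope group_scope.

Lemma multiplicative1 : phi 1 = 1.
Proof. by apply: (@mulgI _ (phi 1)); rewrite -gmulfM !mulg1. Qed.

Lemma multiplicativeX g k : phi (g ^+ k) = phi g ^+ k.
Proof.
by elim: k => [|k IHk]; rewrite ?expg0 ?multiplicative1 // !expgS gmulfM IHk.
Qed.

End Multiplicative.

(** * Presented groups and their actions *)

Section PresentedAction.
Variables (X : choiceType) (R : word X -> word X -> Prop).
Local Notation G := (presented_group R).
Local Open Scope group_scope.

Definition pgen (x : X) : G := \pi_G (gen x).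

Lemma pi_cat (u v : word X) : \pi_G (u ++ v) = \pi_G u * \pi_G v.
Proof. by rewrite -pi_pres_mul. Qed.

Lemma pi_nil : \pi_G [::] = 1.
Proof. by []. Qed.

Lemma pi_inv_gen (x : X) : \pi_G [:: (x, true)] = (pgen x)^-1.
Proof.
apply: (@mulgI _ (pgen x)); rewrite mulgV -pi_cat.
exact/presP/(pres_cancel R x false).
Qed.

(** Requiring an equivalence for each generator makes one condition serve for
    both signs of a letter: a step by the inverse of a generator is read as
    a cancellation. *)
Lemma presented_group_ind (P : G -> Prop) :
  P 1 -> (forall x g, P (pgen x * g) <-> P g) -> forall g, P g.
Proof.
move=> P1 Pgen; elim/quotW; elim=> [|[x b] w IHw]; first by rewrite pi_nil.
rewrite -cat1s pi_cat; case: b; last exact/Pgen.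
by apply/(Pgen x); rewrite pi_inv_gen mulgA mulgV mul1g.
Qed.

Variables (T : Type) (f : X * bool -> T -> T).

Definition word_act (w : word X) (s : T) : T := foldr f s w.

Lemma word_act_cat u v s : word_act (u ++ v) s = word_act u (word_act v s).
Proof. exact: foldr_cat. Qed.

Hypothesis f_cancel : forall x b, cancel (f (x, ~~ b)) (f (x, b)).
Hypothesis f_rel : forall u v, R u v -> word_act u =1 word_act v.

Lemma word_act_pres_eq u v : pres_eq R u v -> word_act u =1 word_act v.
Proof.
elim=> {u v} [u v /f_rel //|x b|//|u v _ IH s|u v w _ uv _ vw s|u u' v v'].
- exact: f_cancel.
- by rewrite IH.
- by rewrite uv vw.
- by move=> _ uu' _ vv' s; rewrite !word_act_cat vv' uu'.
Qed.

Definition pres_act (g : G) : T -> T := word_act (repr g).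

Lemma pres_act_pi w : pres_act (\pi_G w) =1 word_act w.
Proof. exact/word_act_pres_eq/pres_repr. Qed.

Lemma pres_act1 s : pres_act 1 s = s.
Proof. by rewrite -pi_nil pres_act_pi. Qed.

Lemma pres_actM g h s : pres_act (g * h) s = pres_act g (pres_act h s).
Proof. by rewrite -[g * h]/(\pi_G _) pres_act_pi word_act_cat. Qed.

Lemma pres_act_inj g : injective (pres_act g).
Proof.
by apply: (can_inj (g := pres_act g^-1)) => s; rewrite -pres_actM mulVg pres_act1.
Qed.

End PresentedAction.

(** An element whose image commutes with the images of the generators commutes
    with all images.  Applied to a generator this makes its image central, and
    then the hypothesis is met by every element. *)
Lemma presented_action_commutative (X : choiceType)
    (R : word X -> word X -> Prop) (T : Type)
    (F : presented_group R -> T -> T) :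
    (forall s, F 1%g s = s) -> (forall g h s, F (g * h)%g s = F g (F h s)) ->
    (forall g, injective (F g)) ->
    (forall x y s, F (pgen R x) (F (pgen R y) s) =
                   F (pgen R y) (F (pgen R x) s)) ->
  forall g h s, F g (F h s) = F h (F g s).
Proof.
move=> F1 FM Finj Fgen.
have step h : (forall x s, F (pgen R x) (F h s) = F h (F (pgen R x) s)) ->
    forall g s, F g (F h s) = F h (F g s).
  move=> hC; elim/presented_group_ind=> [s|x g]; first by rewrite !F1.
  split=> gC s; last by rewrite !FM gC hC.
  by apply: (Finj (pgen R x)); have := gC s; rewrite !FM -hC.
move=> g h; apply: (step) => x s.
by symmetry; move: s; apply: step => y s; rewrite Fgen.
Qed.

(** * The affine action on the rationals *)

Section GammaAction.
Variable n : nat.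
Local Notation rank := (Gamma_rank n).
Local Notation G := (Gamma n).

Definition aff_letter (l : Gamma_gen n * bool) (x : rat) : rat :=
  match l with
  | (None, false) => x + 1
  | (None, true) => x - 1
  | (Some i, false) => (Gamma_pow i)%:R * x
  | (Some i, true) => (Gamma_pow i)%:R^-1 * x
  end.

Lemma Gamma_pow_gt1 (i : 'I_rank) : (1 < Gamma_pow i)%N.
Proof.
rewrite /Gamma_pow; set p := tnth _ i.
have pn : p \in primes n by exact: mem_tnth.
have p_pr : prime p by move: pn; rewrite mem_primes => /and3P[].
apply: leq_ltn_trans (ltn_expl _ (prime_gt1 p_pr)).
by rewrite logn_gt0.
Qed.

Lemma Gamma_pow_gt0 (i : 'I_rank) : 0 < (Gamma_pow i)%:R :> rat.
Proof. by rewrite ltr0n ltnW // Gamma_pow_gt1. Qed.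

Lemma Gamma_pow_neq0 (i : 'I_rank) : (Gamma_pow i)%:R != 0 :> rat.
Proof. by rewrite gt_eqF // Gamma_pow_gt0. Qed.

Lemma aff_letter_cancel x b : cancel (aff_letter (x, ~~ b)) (aff_letter (x, b)).
Proof.
by case: x b => [i|] [] q /=;
  rewrite ?(mulKf (Gamma_pow_neq0 i)) ?(mulVKf (Gamma_pow_neq0 i)) ?addrK ?subrK.
Qed.

Lemma aff_translation k x :
  word_act aff_letter (flatten (nseq k (Gamma_a n))) x = x + k%:R.
Proof.
elim: k => [|k IHk] /=; first by rewrite addr0.
by move: IHk; rewrite /word_act /= => ->; rewrite -addrA -natr1.
Qed.

Lemma aff_letter_rel u v :
  Gamma_rel u v -> word_act aff_letter u =1 word_act aff_letter v.
Proof.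
case=> [i j _|i] x; first by rewrite /word_act /= mulrCA.
rewrite aff_translation /word_act /= mulrDr mulr1.
by rewrite (mulVKf (Gamma_pow_neq0 i)).
Qed.

Definition aff : G -> rat -> rat := pres_act aff_letter.

Lemma aff1 x : aff 1%g x = x.
Proof. exact: (pres_act1 aff_letter_cancel aff_letter_rel). Qed.

Lemma affM g h x : aff (g * h)%g x = aff g (aff h x).
Proof. exact: (pres_actM aff_letter_cancel aff_letter_rel). Qed.

Lemma aff_inj g : injective (aff g).
Proof. exact: (pres_act_inj aff_letter_cancel aff_letter_rel). Qed.

Definition gam_a : G := pgen _ None.
Definition gam_t (i : 'I_rank) : G := pgen _ (Some i).

Lemma aff_a x : aff gam_a x = x + 1.
Proof. exact: (pres_act_pi aff_letter_cancel aff_letter_rel). Qed.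

Lemma aff_t i x : aff (gam_t i) x = (Gamma_pow i)%:R * x.
Proof. exact: (pres_act_pi aff_letter_cancel aff_letter_rel). Qed.

Definition slope (g : G) : rat := aff g 1 - aff g 0.

(** Each letter acts by an affine map of positive slope, and such maps are
    closed under composition.  The slope of an affine map is its value at 1
    minus its value at 0. *)
Lemma aff_slope_gt0 g : (forall x, aff g x = slope g * x + aff g 0) /\ 0 < slope g.
Proof.
suff [c c0 cP]: exists2 c, 0 < c & forall x, aff g x = c * x + aff g 0.
  suff -> : slope g = c by [].
  by rewrite /slope cP mulr1 addrK.
rewrite /aff /pres_act; elim: (repr g) => [|l w [c c0 cP]].
  by exists 1 => // x; rewrite /word_act /= mul1r addr0.
rewrite -[l :: w]cat1s.
case: l => [[i|] b].
  exists (if b then (Gamma_pow i)%:R^-1 * c else (Gamma_pow i)%:R * c).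
    by case: b; rewrite mulr_gt0 ?invr_gt0 ?Gamma_pow_gt0.
  by move=> x; rewrite !word_act_cat cP; case: b => /=; rewrite mulrDr mulrA.
exists c => // x; rewrite !word_act_cat cP.
by case: b => /=; rewrite addrA.
Qed.

Lemma affE g x : aff g x = slope g * x + aff g 0.
Proof. by case: (aff_slope_gt0 g). Qed.

Lemma slope_gt0 g : 0 < slope g.
Proof. by case: (aff_slope_gt0 g). Qed.

Lemma slopeM g h : slope (g * h)%g = slope g * slope h.
Proof.
by rewrite {1}/slope !affM (affE g (aff h 1)) (affE g (aff h 0)) /slope; ring.
Qed.

Lemma slope1 : slope 1%g = 1.
Proof. by rewrite /slope !aff1 subr0. Qed.

Lemma slope_a : slope gam_a = 1.
Proof. by rewrite /slope !aff_a; ring. Qed.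

Lemma slope_t i : slope (gam_t i) = (Gamma_pow i)%:R.
Proof. by rewrite /slope !aff_t; ring. Qed.

Lemma slopeX g k : slope (g ^+ k)%g = slope g ^+ k.
Proof.
by elim: k => [|k IHk]; rewrite ?expg0 ?slope1 // expgS slopeM IHk exprS.
Qed.

Lemma gam_tC i j : (gam_t i * gam_t j = gam_t j * gam_t i)%g.
Proof.
have [->//|neq_ij] := eqVneq i j.
rewrite -!pi_cat; apply/presP/pres_rel; exact: Gamma_rel_comm.
Qed.

Lemma gam_ta i : (gam_t i * gam_a = gam_a ^+ Gamma_pow i * gam_t i)%g.
Proof.
have piX k : \pi_G (flatten (nseq k (Gamma_a n))) = (gam_a ^+ k)%g.
  elim: k => [|k IHk]; first by rewrite expg0.
  by rewrite /= -cat1s pi_cat IHk expgS.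
have := pres_rel (Gamma_rel_conj i) => /presP.
rewrite piX !pi_cat pi_inv_gen => <-.
by rewrite -!mulgA mulVg mulg1.
Qed.

(** * Automorphisms preserve the slope *)

Section Endomorphism.
Variable phi : {multiplicative G -> G}.

(** The slope of phi gam_a is a positive fixed point of s |-> s ^ q_i, where
    q_i >= 2.  Positivity excludes the roots 0 and -1.  The index i
    ensures that there is a relation of this kind to use. *)
Lemma slope_phi_a (i : 'I_rank) : slope (phi gam_a) = 1.
Proof.
have /(congr1 (slope \o phi)) := gam_ta i.
rewrite /= !gmulfM multiplicativeX !slopeM slopeX mulrC.
move/(mulIf (lt0r_neq0 (slope_gt0 _))).
rewrite -[Gamma_pow i]prednK ?(ltnW (Gamma_pow_gt1 i)) // exprS -[LHS]mulr1.
move/(mulfI (lt0r_neq0 (slope_gt0 _)))/esym/eqP.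
rewrite pexpr_eq1 ?ltW ?slope_gt0 //; first by move/eqP.
by rewrite -ltnS prednK ?(ltnW (Gamma_pow_gt1 i)) // Gamma_pow_gt1.
Qed.

Hypothesis phi_surj : forall g, exists h, phi h = g.

(** Otherwise phi gam_a acts trivially and the whole image of phi acts by
    commuting maps, although the actions of gam_a and gam_t i do not commute:
    they send 0 to q_i or to 1 according to the order. *)
Lemma aff_phi_a_neq0 (i : 'I_rank) : aff (phi gam_a) 0 != 0.
Proof.
apply/eqP => a0.
have phi_a x : aff (phi gam_a) x = x.
  by rewrite affE a0 addr0 (slope_phi_a i) mul1r.
have comm : forall g h x, aff (phi g) (aff (phi h) x) = aff (phi h) (aff (phi g) x).
  apply: (presented_action_commutative (F := fun g => aff (phi g))).
  - by move=> x; rewrite multiplicative1 aff1.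
  - by move=> g h x; rewrite gmulfM affM.
  - by move=> g; apply: aff_inj.
  - move=> [j|] [k|] x /=; rewrite ?phi_a //.
    by rewrite -!affM -!gmulfM -/(gam_t j) -/(gam_t k) gam_tC.
have [[g ga] [h ht]] := (phi_surj gam_a, phi_surj (gam_t i)).
(* Evaluation at 0 turns the commutation of aff gam_a with aff (gam_t i) into
   the equality q_i = 1. *)
have := comm g h 0; rewrite ga ht aff_t !aff_a aff_t mulr0 add0r mulr1.
move/eqP; rewrite eq_sym pnatr_eq1 => /eqP q1.
by have := Gamma_pow_gt1 i; rewrite q1.
Qed.

(** Conjugation by phi (gam_t i) multiplies the translation length b of
    phi gam_a by the slope of phi (gam_t i), and by q_i in view of the defining
    relation. *)
Lemma slope_phi_t i : slope (phi (gam_t i)) = (Gamma_pow i)%:R.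
Proof.
set b := aff (phi gam_a) 0.
have phi_aX k x : aff (phi gam_a ^+ k)%g x = x + k%:R * b.
  elim: k => [|k IHk]; first by rewrite expg0 aff1 mul0r addr0.
  by rewrite expgS affM IHk affE (slope_phi_a i) -natr1 -/b; ring.
have /(congr1 (fun g => aff (phi g) 0)) := gam_ta i.
rewrite !gmulfM multiplicativeX !affM phi_aX affE -/b addrC.
by move/addrI/(mulIf (aff_phi_a_neq0 i)).
Qed.

Lemma slope_phi (i : 'I_rank) g : slope (phi g) = slope g.
Proof.
elim/presented_group_ind: g => [|x g]; first by rewrite multiplicative1.
have gen_x : slope (phi (pgen _ x)) = slope (pgen _ x).
  by case: x => [j|]; [rewrite slope_phi_t slope_t | rewrite (slope_phi_a i) slope_a].
rewrite gmulfM !slopeM gen_x; split=> [|-> //].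
exact/mulfI/lt0r_neq0/slope_gt0.
Qed.

End Endomorphism.
End GammaAction.

(** * Twisted conjugacy *)

(** A phi-invariant multiplicative function with commutative values is constant
    on phi-twisted classes, because the factors of z and of (phi z)^-1 cancel.
    Elements with distinct values then lie in distinct classes. *)
Lemma infinite_twisted_classes (G : groupType) (phi : {multiplicative G -> G})
    (F : comPzRingType) (chi : G -> F) (e : nat -> G) :
    (forall g h, chi (g * h)%g = chi g * chi h) -> chi 1%g = 1 ->
    (forall g, chi (phi g) = chi g) -> injective (chi \o e) ->
  infinite_set (range (twisted_class phi)).
Proof.
move=> chiM chi1 chi_phi chi_e fin.
have chi_twisted g h : twisted_conj phi g h -> chi h = chi g.
  move=> [z <-].
  have zV : chi z * chi (phi z)^-1%g = 1 by rewrite -chi_phi -chiM mulgV.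
  by rewrite !chiM mulrAC zV mul1r.
apply: infinite_nat.
have class_inj : injective (twisted_class phi \o e).
  move=> i j /(congr1 (@^~ (e i))) eq_ij; apply: chi_e; apply: chi_twisted.
  (* The class of e i contains e i, so equal classes put e i in that of e j. *)
  have: twisted_class phi (e i) (e i).
    by exists 1%g; rewrite mul1g multiplicative1 invg1 mulg1.
  by rewrite [twisted_class _ _ _]eq_ij.
apply: (sub_finite_set _ (finite_preimage _ fin)); last exact: in2W class_inj.
by move=> i _; exists (e i).
Qed.

Local Close Scope ring_scope.

Theorem corollary5p2 (n : nat) (hn : 2 <= n) : R_infty (Gamma n).
Proof.
move=> phi [psi _ psiK].
have rank_gt0 : (0 < Gamma_rank n)%N.
  rewrite /Gamma_rank lt0n size_eq0; apply/negP => /eqP no_primes.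
  have := mem_primes (pdiv n) n.
  by rewrite no_primes pdiv_prime // pdiv_dvd (ltnW hn).
pose i := Ordinal rank_gt0.
have phi_surj g : exists h, phi h = g by exists (psi g).
apply: (infinite_twisted_classes (chi := @slope n) (e := fun k => (gam_t i ^+ k)%g)).
- exact: slopeM.
- exact: slope1.
- exact: (slope_phi phi_surj i).
move=> k l; rewrite /= !slopeX slope_t; apply: ieexprIn.
  exact: Gamma_pow_gt0.
by rewrite pnatr_eq1 gtn_eqF // Gamma_pow_gt1.
Qed.
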